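(* Let $G$ be a finite group and $H$ a connected directed graph with a rotation system, cellularly embedded in the oriented closed surface $S$ determined by the rotation system, with dual $H^*$. For every $G$-flow $\psi$ on $H$, letting $\psi^*(e^* )=\psi(e)$, the pair consisting of the covering $\ell: H^*_{\psi^*} \to H^*$ and the map $\psi^*_\ell = \psi^*\circ \ell$ is a minimal global covering tension on $H^*$. Conversely, every minimal global covering tension $(s: K \to H^*, \phi)$ on $H^*$ yields a $G$-flow on $H$, namely $e \mapsto (\phi\circ s^{-1})(e^* )$.
   Context: Graphs may have multiple edges and loops. Rotation system: a cyclic order of edge-ends at each vertex (a loop contributes two). Faces: closed walks obtained by face tracing (after entering $w$ along an edge, leave along the next edge-end in the cyclic order at $w$). $G$-flow: listing edge-ends at $v$ cyclically as $e_v^1,\dots,e_v^{d(v)}$ with $\sigma_v=+1$ if the edge enters $v$ and $-1$ if it leaves, a map $\psi: E\to G$ with $\prod_i\psi(e_v^i)^{\sigma_v(e_v^i)}=1$ at every vertex. Dual $H^*$: a vertex per face of $H$, and per edge $e$ of $H$ a dual edge $e^*$ joining the faces on both sides of $e$, directed to cross $e$ from its left side to its right side; $H^*$ carries the rotation system induced by the orientation of $S$. Heights: $h_\phi(W)=\prod_i\phi(e_i)^{\pm1}$, exponent $+1$ iff $e_i$ traversed in its direction. Local $G$-tension: height $1$ on all facial walks; global $G$-tension: height $1$ on all closed walks. Covering $s: K\to L$ ($K$ connected with rotation system): surjective graph homomorphism preserving directions, bijective on edge-ends at each vertex and respecting cyclic orders; $\phi_s=\phi\circ s$. Global covering w.r.t.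 a local tension $\phi$ on $L$: a covering $s$ with $\phi_s$ a global tension; it is minimal if every global covering $r: K'\to L$ w.r.t. $\phi$ ($K'$ connected) factors as $r = s\circ q$ with $q: K'\to K$ a covering. A global covering tension on $L$: a covering $s: K\to L$ and a global $G$-tension $\phi$ on $K$ such that $\phi$ is constant on each fibre $s^{-1}(e)$ and the induced map $\phi\circ s^{-1}$ on $E(L)$ is a local $G$-tension; it is minimal if $s$ is a minimal global covering w.r.t. $\phi\circ s^{-1}$. For $L$ with base vertex $x$ and $\phi: E(L)\to G$, $L_\phi$ has vertices $(e(W),h_\phi(W))$ for walks $W$ from $x$ ($e(W)$ the end vertex), and for each vertex $(a,h)$ and edge $f$ of $L$ directed from $a$ to $b$ an edge $(f,h)$ from $(a,h)$ to $(b,h\phi(f))$, with lifted rotation system; $\ell: L_\phi\to L$ is $(u,h)\mapsto u$, $(f,h)\mapsto f$. *)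

(* Defs.v *)
From mathcomp Require Import all_boot all_fingroup.
From mathcomp Require Import boolp classical_sets.

Set Implicit Arguments.
Unset Strict Implicit.
Unset Printing Implicit Defensive.

Local Open Scope group_scope.

(* The end of the edge e at its tail is (e, false), the end at its head is
   (e, true). A walk traverses edges, and traversing an edge away from its end
   d is also denoted by d: (e, false) is e traversed in its direction. *)
Definition dart (E : Type) : Type := (E * bool)%type.

Definition opp (E : Type) (d : dart E) : dart E := (d.1, ~~ d.2).

(* next_endP says that the ends at each vertex form a single finite cycle of next_end:
   next_end d is at the same vertex as d, so d lies on the orbit of next_end d. *)
Record rotgraph (V E : Type) := RotGraph {
  src : E -> V;
  tgt : E -> V;
  next_end : dart E -> dart E;
  next_endP : forall d d' : dart E,
    (if d.2 then tgt d.1 else src d.1) = (if d'.2 then tgt d'.1 else src d'.1)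
    <-> exists n, iter n next_end d = d'
}.

Section Graph.
Variables (V E : Type) (L : rotgraph V E).

Definition org (d : dart E) : V := if d.2 then tgt L d.1 else src L d.1.

Definition face_step (d : dart E) : dart E := next_end L (opp d).

Fixpoint is_walk (a : V) (W : seq (dart E)) (b : V) : Prop :=
  if W is d :: W' then org d = a /\ is_walk (org (opp d)) W' b else a = b.

Definition connected : Prop :=
  inhabited V /\ forall a b, exists W, is_walk a W b.

Lemma oppK : involutive (@opp E).
Proof. by case=> e b; rewrite /opp /= negbK. Qed.

Lemma org_rot d : org (next_end L d) = org d.
Proof. by symmetry; apply/(next_endP L); exists 1%N. Qed.

Lemma rot_inj : injective (next_end L).
Proof.
have per d : exists n, iter n.+1 (next_end L) d = d.
  have [n Hn] := (next_endP L (next_end L d) d).1 (org_rot d).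
  by exists n; rewrite iterSr.
have perM n d m : iter n (next_end L) d = d -> iter (m * n) (next_end L) d = d.
  by move=> Hn; elim: m => // m IH; rewrite mulSn iterD IH.
move=> a b eq_ab; have [[n Hn] [m Hm]] := (per a, per b).
rewrite -[a](perM _ _ m.+1 Hn) -[b](perM _ _ n.+1 Hm) [(n.+1 * _)%N]mulnC.
by rewrite mulSn addSn !iterSr eq_ab.
Qed.

Lemma face_step_inj : injective face_step.
Proof. by move=> a b /rot_inj /(can_inj oppK). Qed.

Lemma is_walk_rcons a W d : is_walk a W (org d) ->
  is_walk a (rcons W d) (org (opp d)).
Proof. by elim: W a => [a -> //|c W IH a [<- /IH]]. Qed.

End Graph.

Section Tension.
Variables (gT : finGroupType) (V E : Type) (L : rotgraph V E) (phi : E -> gT).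

Definition height (W : seq (dart E)) : gT :=
  \prod_(d <- W) (if d.2 then (phi d.1)^-1 else phi d.1).

Definition global_tension : Prop :=
  forall a W, is_walk L a W a -> height W = 1.

End Tension.

(* A repetition-free cycle of face_step is exactly a facial walk, up to the
   choice of its first edge; the empty one is the boundary of the face around
   an isolated vertex. *)
Definition local_tension (gT : finGroupType) (V : Type) (E : eqType)
    (L : rotgraph V E) (phi : E -> gT) : Prop :=
  forall W, ucycle (frel (face_step L)) W -> height phi W = 1.

Definition flow (gT : finGroupType) (V E : eqType) (H : rotgraph V E)
    (psi : E -> gT) : Prop :=
  forall (v : V) (s : seq (dart E)),
    ucycle (frel (next_end H)) s -> (forall d, (d \in s) = (org H d == v)) ->
    \prod_(d <- s) (if d.2 then psi d.1 else (psi d.1)^-1) = 1.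

(* Rotations are taken to be counterclockwise in the oriented surface S. Then
   face tracing keeps the face on the right: face_of d is the face to the right
   of d, and the faces are traversed clockwise. *)
Section Dual.
Variables (V E : finType) (H : rotgraph V E).

Definition face_of (d : dart E) : {set E * bool} :=
  [set c | fconnect (face_step H) d c]%SET.

Definition isolated (v : V) : bool :=
  [forall e, (src H e != v) && (tgt H e != v)].

(* The second summand is the face around an isolated vertex, whose facial walk
   has no edges; for connected H it is used only if H is a single vertex. *)
Definition face : Type :=
  ({F : {set E * bool} | F \in codom face_of} + {v : V | isolated v})%type.

Definition right_face (d : dart E) : face :=
  inl (exist (fun F => F \in codom face_of) (face_of d) (codom_f face_of d)).

Definition left_face (d : dart E) : face := right_face (opp d).

(* The end D of a dual edge lies in left_face D = right_face (opp D), and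
   counterclockwise is the reverse of the order in which that face is traced. *)
Definition dual_rot (D : dart E) : dart E :=
  opp (finv (face_step H) (opp D)).

Lemma dual_rotP (D D' : dart E) :
  (if D.2 then right_face (D.1, false) else left_face (D.1, false)) =
  (if D'.2 then right_face (D'.1, false) else left_face (D'.1, false))
  <-> exists n, iter n dual_rot D = D'.
Proof.
have inj := @face_step_inj _ _ H.
have orgE (C : dart E) :
    (if C.2 then right_face (C.1, false) else left_face (C.1, false))
    = right_face (opp C) by case: C => e [].
have iterE n C :
    iter n dual_rot C = opp (iter n (finv (face_step H)) (opp C)).
  elim: n => [|n IH] /=; first by rewrite oppK.
  by rewrite IH /dual_rot oppK.
have rfE c d : right_face c = right_face d <-> fconnect (face_step H) c d.
  split=> [[/setP/(_ d)]|cd]; first by rewrite !inE connect0.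
  have eqF : face_of c = face_of d.
    by apply/setP=> z; rewrite !inE (same_connect (fconnect_sym inj) cd).
  by congr inl; apply: val_inj.
rewrite !orgE rfE -(same_fconnect_finv inj); split=> [h|[n <-]].
  by exists (findex (finv (face_step H)) (opp D) (opp D'));
    rewrite iterE iter_findex // oppK.
by rewrite iterE oppK fconnect_iter.
Qed.

(* The dual edge of e is e itself, regarded as an edge of the dual. *)
Definition dual : rotgraph face E :=
  @RotGraph face E (fun e => left_face (e, false)) (fun e => right_face (e, false))
    dual_rot dual_rotP.

End Dual.

Record gmap (VK EK VL EL : Type) := GMap { on_v : VK -> VL; on_e : EK -> EL }.

Definition on_d (VK EK VL EL : Type) (s : gmap VK EK VL EL) (d : dart EK) :
  dart EL := (on_e s d.1, d.2).

Record is_covering (VK EK VL EL : Type) (K : rotgraph VK EK) (L : rotgraph VL EL)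
    (s : gmap VK EK VL EL) : Prop := IsCovering {
  cov_connected : connected K;
  cov_src : forall e, src L (on_e s e) = on_v s (src K e);
  cov_tgt : forall e, tgt L (on_e s e) = on_v s (tgt K e);
  cov_surj_v : forall w, exists v, on_v s v = w;
  cov_surj_e : forall f, exists e, on_e s e = f;
  cov_bij : forall v d', org L d' = on_v s v ->
    exists! d, org K d = v /\ on_d s d = d';
  cov_rot : forall d, on_d s (next_end K d) = next_end L (on_d s d)
}.

Section Coverings.
Variables (gT : finGroupType) (VL : Type) (EL : eqType) (L : rotgraph VL EL).

Definition global_covering (phi : EL -> gT) (VK EK : Type) (K : rotgraph VK EK)
    (s : gmap VK EK VL EL) : Prop :=
  [/\ local_tension L phi, is_covering K L s
    & global_tension K (phi \o on_e s)].

Definition minimal_global_covering (phi : EL -> gT) (VK EK : Type)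
    (K : rotgraph VK EK) (s : gmap VK EK VL EL) : Prop :=
  global_covering phi K s /\
  forall (VK' EK' : Type) (K' : rotgraph VK' EK') (r : gmap VK' EK' VL EL),
    global_covering phi K' r ->
    exists q : gmap VK' EK' VK EK,
      [/\ is_covering K' K q, on_v r =1 on_v s \o on_v q
        & on_e r =1 on_e s \o on_e q].

(* The element of the set phi (s^-1 f), which is a singleton whenever s is
   surjective on edges and phi is constant on the fibres of s. *)
Definition descend (VK EK : Type) (s : gmap VK EK VL EL) (phi : EK -> gT)
    (f : EL) : gT :=
  xget 1 (phi @` (on_e s @^-1` [set f]))%classic.

Definition global_covering_tension (VK EK : Type) (K : rotgraph VK EK)
    (s : gmap VK EK VL EL) (phi : EK -> gT) : Prop :=
  [/\ is_covering K L s, global_tension K phi,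
      forall e e', on_e s e = on_e s e' -> phi e = phi e'
    & local_tension L (descend s phi)].

Definition minimal_global_covering_tension (VK EK : Type) (K : rotgraph VK EK)
    (s : gmap VK EK VL EL) (phi : EK -> gT) : Prop :=
  global_covering_tension K s phi /\
  minimal_global_covering (descend s phi) K s.

End Coverings.

(* The graph L_phi with base vertex x. *)
Section Derived.
Variables (gT : finGroupType) (V E : Type) (L : rotgraph V E) (x : V).
Variable phi : E -> gT.

Definition reached (p : V * gT) : Prop :=
  exists2 W, is_walk L x W p.1 & height phi W = p.2.

Definition dvertex : Type := {p : V * gT | `[< reached p >]}.

Definition dedge : Type := {p : E * gT | `[< reached (src L p.1, p.2) >]}.

Lemma reached_opp (d : dart E) h : reached (org L d, h) ->
  reached (org L (opp d), h * (if d.2 then (phi d.1)^-1 else phi d.1)).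
Proof.
case=> W /= wW <-; exists (rcons W d); first exact: is_walk_rcons.
by rewrite /height -cats1 big_cat big_seq1.
Qed.

Lemma dtgt_subproof (e : dedge) :
  `[< reached (tgt L (val e).1, (val e).2 * phi (val e).1) >].
Proof.
case: e => [[f h] /= /asboolP r]; apply/asboolP.
exact: (@reached_opp (f, false)).
Qed.

Definition dsrc (e : dedge) : dvertex :=
  exist _ (src L (val e).1, (val e).2) (valP e).

Definition dtgt (e : dedge) : dvertex :=
  exist (fun p => `[< reached p >])
    (tgt L (val e).1, (val e).2 * phi (val e).1) (dtgt_subproof e).

Definition dbase (D : dart dedge) : dart E := ((val D.1).1, D.2).

Definition dheight (D : dart dedge) : gT :=
  if D.2 then (val D.1).2 * phi (val D.1).1 else (val D.1).2.

(* The edge of L_phi that has an end over d at the vertex (org L d, k). *)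
Definition dlift (d : dart E) (k : gT) : E * gT :=
  (d.1, if d.2 then k * (phi d.1)^-1 else k).

Lemma drot_subproof (D : dart dedge) :
  `[< reached (src L (dlift (next_end L (dbase D)) (dheight D)).1,
               (dlift (next_end L (dbase D)) (dheight D)).2) >].
Proof.
apply/asboolP; have: reached (org L (dbase D), dheight D).
  case: D => [[[f h] /= r] []]; rewrite /dheight /org /=; last exact/asboolP.
  by move/asboolP: r => /(@reached_opp (f, false)).
rewrite -org_rot; case: (next_end L _) => f [] //=.
by move/(@reached_opp (f, true)).
Qed.

Definition drot (D : dart dedge) : dart dedge :=
  (exist (fun p => `[< reached (src L p.1, p.2) >])
     (dlift (next_end L (dbase D)) (dheight D)) (drot_subproof D),
   (next_end L (dbase D)).2).

Lemma drotP (D D' : dart dedge) :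
  (if D.2 then dtgt D.1 else dsrc D.1) = (if D'.2 then dtgt D'.1 else dsrc D'.1)
  <-> exists n, iter n drot D = D'.
Proof.
have valE (C : dart dedge) : val (if C.2 then dtgt C.1 else dsrc C.1) =
    (org L (dbase C), dheight C) by case: C => e [].
have baseE n : dbase (iter n drot D) = iter n (next_end L) (dbase D).
  by elim: n => //= n <-; rewrite /dbase /=; case: (next_end L _).
have heightE n : dheight (iter n drot D) = dheight D.
  elim: n => //= n <-; rewrite {1}/dheight /=.
  by case: (next_end L _) => f [] //=; rewrite mulgKV.
have inj (C C' : dart dedge) :
    dbase C = dbase C' -> dheight C = dheight C' -> C = C'.
  case: C C' => [[[f h] r] b] [[[f' h'] r'] b'] [/= ff bb]; subst f' b'.
  rewrite /dheight /= => hh; congr pair; apply: val_inj => /=; congr pair.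
  by case: b hh => // /mulIg.
split=> [eqD|[n <-]].
  have := congr1 val eqD; rewrite !valE => -[/(next_endP L)[n Hn] eqh].
  by exists n; apply: inj; rewrite ?baseE ?heightE.
apply: val_inj; rewrite !valE heightE baseE; congr pair.
by elim: n => //= n ->; rewrite org_rot.
Qed.

Definition derived : rotgraph dvertex dedge := RotGraph drotP.

Definition derived_proj : gmap dvertex dedge V E :=
  GMap (fun v : dvertex => (val v).1) (fun e : dedge => (val e).1).

End Derived.

(* Main.v *)
From mathcomp Require Import all_boot all_fingroup.
From mathcomp Require Import boolp classical_sets.
Require Import Defs.

(** A facial walk of the dual is the reverse of the cyclic order of the ends at
    a vertex, so flows on [H] are exactly the local tensions on [dual H].  It
    remains to see that, for a connected graph [L] and a local tension [phi],
    [derived L x phi] is a minimal global covering.  The second component of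
    its vertices is a potential for the lifted tension, which is therefore
    global.  If [r : K -> L] is a global covering and [y] lies over [x], then
    the heights [k v] of walks from [y] to [v] are well defined on [K], and [r]
    factors through the covering [v |-> (r v, k v)]. *)

Set Implicit Arguments.
Unset Strict Implicit.
Unset Printing Implicit Defensive.

Local Open Scope group_scope.

(** * Walks and their heights *)

Section Walks.
Variables (V E : Type) (L : rotgraph V E).

Lemma is_walk_cat a b c W W' :
  is_walk L a W b -> is_walk L b W' c -> is_walk L a (W ++ W') c.
Proof. by elim: W a => [a ->|d W IH a [<- w]] //= w'; split=> //; apply: IH. Qed.

Lemma is_walk_rev a b W :
  is_walk L a W b -> is_walk L b (rev (map (@opp E) W)) a.
Proof.
elim: W a => [a ->|d W IH a [<- /IH w]] //=.
rewrite rev_cons -[d in org L d]oppK; exact: is_walk_rcons.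
Qed.

Lemma height_cat (gT : finGroupType) (phi : E -> gT) W W' :
  height phi (W ++ W') = height phi W * height phi W'.
Proof. exact: big_cat. Qed.

Lemma height_rev (gT : finGroupType) (phi : E -> gT) W :
  height phi (rev (map (@opp E) W)) = (height phi W)^-1.
Proof.
elim: W => [|[e b] W IH]; first by rewrite /height !big_nil invg1.
rewrite map_cons rev_cons -cats1 height_cat IH -(cat1s (e, b)) height_cat invMg.
by congr (_ * _); rewrite /height !big_seq1; case: b; rewrite /= ?invgK.
Qed.

Lemma connected_from x :
  (forall v, exists W, is_walk L x W v) -> connected L.
Proof.
move=> reach; split=> [|a b]; first exact: (inhabits x).
have [[Wa wa] [Wb wb]] := (reach a, reach b).
exists (rev (map (@opp E) Wa) ++ Wb).
exact: is_walk_cat (is_walk_rev wa) wb.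
Qed.

(** [W] followed by the reverse of [W'] is closed. Thus heights of walks from a fixed vertex define
    a potential. *)
Lemma global_tension_unique (gT : finGroupType) (phi : E -> gT) a b W W' :
  global_tension L phi -> is_walk L a W b -> is_walk L a W' b ->
  height phi W = height phi W'.
Proof.
move=> glob w w'; have := glob _ _ (is_walk_cat w (is_walk_rev w')).
by rewrite height_cat height_rev => /eqP; rewrite -eq_mulgV1 => /eqP.
Qed.

End Walks.

(** * Projecting and lifting walks along a covering *)

Section CoveringWalks.
Variables (VK EK VL EL : Type) (K : rotgraph VK EK) (L : rotgraph VL EL).
Variable s : gmap VK EK VL EL.
Hypothesis cov : is_covering K L s.

Lemma cov_org d : org L (on_d s d) = on_v s (org K d).
Proof. by case: d => e []; rewrite /org /= ?(cov_src cov) ?(cov_tgt cov). Qed.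

Lemma is_walk_project a b W :
  is_walk K a W b -> is_walk L (on_v s a) (map (on_d s) W) (on_v s b).
Proof.
elim: W a => [a ->|d W IH a [<- /IH w]] //=; split; first exact: cov_org.
by rewrite -cov_org in w.
Qed.

(** Lift dart by dart: bijectivity on the ends at the current vertex supplies each next dart. *)
Lemma is_walk_lift a b W : is_walk L (on_v s a) W b ->
  exists W' c, [/\ is_walk K a W' c, on_v s c = b & map (on_d s) W' = W].
Proof.
elim: W a => [a <-|d W IH a [od w]]; first by exists [::], a.
have [D [[oD sD] _]] := cov_bij cov od.
have sD' : org L (opp d) = on_v s (org K (opp D)) by rewrite -cov_org -sD.
rewrite sD' in w; have [W' [c [w' sc sW]]] := IH _ w.
by exists (D :: W'), c; split; rewrite //= sD sW.
Qed.

Lemma height_project (gT : finGroupType) (phi : EL -> gT) W :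
  height phi (map (on_d s) W) = height (phi \o on_e s) W.
Proof. by rewrite /height big_map. Qed.

(** By surjectivity the set given to [xget] is exactly the singleton of [phi f], so the default
    value [1] never occurs. *)
Lemma descend_comp (gT : finGroupType) (EL' : eqType) (t : gmap VK EK VL EL')
    (phi : EL' -> gT) :
  (forall f, exists e, on_e t e = f) -> descend t (phi \o on_e t) = phi.
Proof.
move=> surj; apply/funext=> f; rewrite /descend.
have [e te] := surj f.
by case: xgetP => [_ _ [e' /= <- <-] //|/(_ (phi f)) []]; exists e; rewrite //= te.
Qed.

End CoveringWalks.

(** * The derived graph as a global covering *)

Section DerivedCovering.
Variables (gT : finGroupType) (V E : Type) (L : rotgraph V E) (x : V).
Variable phi : E -> gT.
Hypothesis Lconn : connected L.

Local Notation D := (derived L x phi).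
Local Notation pr := (derived_proj L x phi).

Lemma val_org_derived (C : dart (dedge L x phi)) :
  val (org D C) = (org L (on_d pr C), dheight C).
Proof. by case: C => e []. Qed.

(** The height at the origin fixes the second component of the edge: directly at a tail, and after
    cancelling [phi f] at a head. *)
Lemma derived_dart_inj (C C' : dart (dedge L x phi)) :
  on_d pr C = on_d pr C' -> org D C = org D C' -> C = C'.
Proof.
move=> eqb /(congr1 val); rewrite !val_org_derived => -[_].
case: C C' eqb => [[[f h] r] b] [[[f' h'] r'] b'] [/= ff bb]; subst f' b'.
rewrite /dheight /= => hh; congr pair; apply: val_inj => /=; congr pair.
by case: b hh => // /mulIg.
Qed.

Lemma derived_dart_lift (v : dvertex L x phi) d : org L d = (val v).1 ->
  exists C, org D C = v /\ on_d pr C = d.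
Proof.
case: v => [[a k] r] /= od.
have rk : reached L x phi (org L d, k) by rewrite od; apply/asboolP.
have re : `[< reached L x phi (src L (dlift phi d k).1, (dlift phi d k).2) >].
  apply/asboolP; case: d {od} rk => f [] //=.
  by move/(@reached_opp _ _ _ _ _ _ (f, true)).
exists (exist _ (dlift phi d k) re, d.2); split; last exact/esym/surjective_pairing.
apply: val_inj; rewrite val_org_derived /= -od; congr pair.
by rewrite /dheight /=; case: d.2; rewrite ?mulgKV.
Qed.

Lemma derived_walk_lift (v : dvertex L x phi) W b : is_walk L (val v).1 W b ->
  exists W' (c : dvertex L x phi),
    is_walk D v W' c /\ val c = (b, (val v).2 * height phi W).
Proof.
elim: W v => [v <-|d W IH v [od w]].
  exists [::], v; split=> //.
  by rewrite /height big_nil mulg1; case: (val v).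
have [C [oC sC]] := derived_dart_lift od.
have vopp : val (org D (opp C)) =
    (org L (opp d), (val v).2 * (if d.2 then (phi d.1)^-1 else phi d.1)).
  rewrite -oC !val_org_derived -sC; congr pair.
  by case: {oC sC} C => e []; rewrite /dheight //= mulgK.
have w' : is_walk L (val (org D (opp C))).1 W b by rewrite vopp.
have [W' [c [wW' vc]]] := IH _ w'.
exists (C :: W'), c; split=> //.
by rewrite vc vopp /= /height big_cons mulgA.
Qed.

(** The second component of a vertex is a potential for the lifted map. *)
Lemma derived_height (a b : dvertex L x phi) W : is_walk D a W b ->
  (val b).2 = (val a).2 * height (phi \o on_e pr) W.
Proof.
elim: W a => [a ->|C W IH a [<- /IH ->]]; first by rewrite /height big_nil mulg1.
rewrite /height big_cons mulgA; congr (_ * _).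
by case: C => e []; rewrite /= ?mulgK.
Qed.

Lemma derived_global_tension : global_tension D (phi \o on_e pr).
Proof.
move=> a W /derived_height /eqP.
by rewrite -{1}[(val a).2]mulg1 => /eqP /mulgI.
Qed.

Lemma reached_base : `[< reached L x phi (x, 1) >].
Proof. by apply/asboolP; exists [::] => //; rewrite /height big_nil. Qed.

Definition derived_base : dvertex L x phi :=
  exist (fun p => `[< reached L x phi p >]) (x, 1) reached_base.

Lemma derived_covering : is_covering D L pr.
Proof.
have surj w : exists v : dvertex L x phi, (val v).1 = w.
  have [W wW] := Lconn.2 x w.
  have r : `[< reached L x phi (w, height phi W) >] by apply/asboolP; exists W.
  by exists (exist (fun p => `[< reached L x phi p >]) _ r).
split=> //.
(* A vertex [(a, k)] comes with a walk from [x] of height [k]; its lift from [(x, 1)] ends at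
   [(a, 1 * k)]. *)
- apply: (connected_from (x := derived_base)) => -[[a k] r].
  have /asboolP [W wW hW] := r.
  have [W' [c [wW' vc]]] := @derived_walk_lift derived_base _ _ wW.
  exists W'; congr (is_walk _ _ _ _): wW'.
  by apply: val_inj; rewrite vc /= mul1g hW.
- move=> f; have [v vE] := surj (src L f).
  have [C [_ cE]] := @derived_dart_lift v (f, false) (esym vE).
  by exists C.1; case: cE.
- move=> v d /derived_dart_lift[C [oC sC]]; exists C; split=> // C' [oC' sC'].
  by apply: derived_dart_inj; rewrite ?oC ?sC.
- by move=> C; rewrite /on_d /= -surjective_pairing.
Qed.

(** * Factoring a global covering through the derived graph *)

Section Factor.
Variables (VK EK : Type) (K : rotgraph VK EK) (r : gmap VK EK V E).
Hypothesis rcov : is_covering K L r.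
Hypothesis rglob : global_tension K (phi \o on_e r).
Variables (y : VK) (yx : on_v r y = x).

Let walk_to v := sval (cid ((cov_connected rcov).2 y v)).

Let walk_toP v : is_walk K y (walk_to v) v.
Proof. exact: svalP (cid ((cov_connected rcov).2 y v)). Qed.

Let pot v := height (phi \o on_e r) (walk_to v).

(** Since the lifted map is a global tension, the walk picked by [cid] does not affect [pot]. *)
Let potE v W : is_walk K y W v -> pot v = height (phi \o on_e r) W.
Proof. exact: global_tension_unique rglob (walk_toP v). Qed.

Let pot_reached v : `[< reached L x phi (on_v r v, pot v) >].
Proof.
apply/asboolP; exists (map (on_d r) (walk_to v)).
  by rewrite -yx; apply: (is_walk_project rcov) (walk_toP v).
exact: height_project.
Qed.

Let pot_tgt e : pot (tgt K e) = pot (src K e) * phi (on_e r e).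
Proof.
rewrite (potE (is_walk_rcons (d := (e, false)) (walk_toP (src K e)))).
by rewrite -cats1 height_cat {2}/height big_seq1.
Qed.

Let edge_reached e :
  `[< reached L x phi (src L (on_e r e, pot (src K e)).1, pot (src K e)) >].
Proof. by rewrite /= (cov_src rcov). Qed.

Let fv v : dvertex L x phi := exist _ (on_v r v, pot v) (pot_reached v).

Let fe e : dedge L x phi :=
  exist (fun p => `[< reached L x phi (src L p.1, p.2) >])
    (on_e r e, pot (src K e)) (edge_reached e).

Let q : gmap VK EK (dvertex L x phi) (dedge L x phi) := GMap fv fe.

Let q_org d : org D (on_d q d) = on_v q (org K d).
Proof.
apply: val_inj; rewrite val_org_derived /=; congr pair.
  exact: (cov_org rcov d).
by case: d => e []; rewrite /dheight //= -pot_tgt.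
Qed.

(** The walk from [x] witnessing that [(b, k)] is reached lifts to [K] from [y]; the end of the lift
    has potential [k]. *)
Let q_surj_v w : exists v, on_v q v = w.
Proof.
case: w => [[b k] rbk]; have /asboolP [W /= wW hW] := rbk.
rewrite -yx in wW; have [W' [c [wW' rc sW]]] := is_walk_lift rcov wW.
exists c; apply: val_inj; rewrite /= rc (potE wW') -hW -sW.
by rewrite height_project.
Qed.

Lemma derived_factor : exists q : gmap VK EK (dvertex L x phi) (dedge L x phi),
  [/\ is_covering K D q, on_v r =1 on_v pr \o on_v q
    & on_e r =1 on_e pr \o on_e q].
Proof.
(* The dart of [K] is found through [r], over the projection of [C] to [L]; its image under [q] is
   [C] because a dart of [D] is determined by its projection and origin. *)
have qbij v C : org D C = on_v q v -> exists! d, org K d = v /\ on_d q d = C.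
  move=> oC; have oL : org L (on_d pr C) = on_v r v.
    by have := congr1 val oC; rewrite val_org_derived => -[].
  have [d [[od sd] dU]] := cov_bij rcov oL.
  exists d; split=> [|d' [od' sd']].
    by split=> //; apply: derived_dart_inj; rewrite ?q_org ?od.
  by apply: dU; split=> //; rewrite -sd'.
exists q; split=> //; split=> //.
- exact: cov_connected rcov.
- by move=> e; apply: (q_org (e, false)).
- by move=> e; apply: (q_org (e, true)).
- move=> f; have [v vE] := q_surj_v (src D f).
  have [d [[_ sd] _]] := @qbij v (f, false) (esym vE).
  by exists d.1; case: sd.
- move=> d; apply: derived_dart_inj; last first.
    by rewrite q_org !org_rot q_org.
  rewrite (cov_rot derived_covering); exact: cov_rot rcov d.
Qed.

End Factor.
End DerivedCovering.

Lemma derived_minimal_global_covering (gT : finGroupType) (V : Type)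
    (E : eqType) (L : rotgraph V E) (x : V) (phi : E -> gT) :
  connected L -> local_tension L phi ->
  minimal_global_covering L phi (derived L x phi) (derived_proj L x phi).
Proof.
move=> Lconn loc; split.
  split=> //; first exact: derived_covering.
  exact: derived_global_tension.
move=> VK EK K r [_ rcov rglob]; have [y yx] := cov_surj_v rcov x.
exact: (derived_factor Lconn rcov rglob yx).
Qed.

Lemma derived_minimal_global_covering_tension (gT : finGroupType) (V : Type)
    (E : eqType) (L : rotgraph V E) (x : V) (phi : E -> gT) :
  connected L -> local_tension L phi ->
  minimal_global_covering_tension L (derived L x phi) (derived_proj L x phi)
    (phi \o on_e (derived_proj L x phi)).
Proof.
move=> Lconn loc; have cov := derived_covering x phi Lconn.
rewrite /minimal_global_covering_tension /global_covering_tension.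
(* The lifted map descends to [phi] itself, so the clauses about [descend] become clauses about
   [phi]. *)
rewrite (descend_comp _ (cov_surj_e cov)).
split; last exact: derived_minimal_global_covering.
split=> //; first exact: derived_global_tension.
by move=> e e' /= ->.
Qed.

(** * Flows as local tensions on the dual *)

Section Dual.
Variables (V E : finType) (H : rotgraph V E).

(** The [opp] in face tracing cancels the inner one in [dual_rot], so a dual face step is [opp]
    after the inverse of [face_step H], that is, the inverse of [next_end H]. *)
Lemma dual_face_step d : next_end H (face_step (dual H) d) = d.
Proof.
have := f_finv (@face_step_inj _ _ H) d.
by rewrite {1}/face_step {2}/face_step /= /dual_rot oppK.
Qed.

Lemma ucycle_dual_rev (W : seq (E * bool)) :
  ucycle (frel (face_step (dual H))) W = ucycle (frel (next_end H)) (rev W).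
Proof.
rewrite /ucycle rev_uniq rev_cycle; congr (is_true (_ && _)).
apply: eq_cycle => c d /=; apply/eqP/eqP=> [<-|<-]; first exact: dual_face_step.
by apply: (@rot_inj _ _ H); rewrite dual_face_step.
Qed.

(** A cycle through [d] is its whole orbit, and orbits are the sets of ends at a vertex by
    [next_endP]. This supplies the membership condition in [flow]. *)
Lemma ucycle_next_end (s : seq (E * bool)) d : ucycle (frel (next_end H)) s ->
  d \in s -> forall c, (c \in s) = (org H c == org H d).
Proof.
case/andP=> cyc _ ds c; apply/idP/eqP=> [cs|].
  apply/(next_endP H); exists (findex (next_end H) c d); apply: iter_findex.
  by rewrite (fconnect_cycle cyc cs).
move/esym/(next_endP H) => [n <-].
by rewrite -(fconnect_cycle cyc ds) fconnect_iter.
Qed.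

(** The exponents in [height] and [flow] are opposite, and inverting a product reverses its
    order. *)
Lemma height_rev_flow (gT : finGroupType) (psi : E -> gT) (s : seq (dart E)) :
  height psi (rev s) =
  (\prod_(d <- s) (if d.2 then psi d.1 else (psi d.1)^-1))^-1.
Proof.
elim: s => [|[e b] s IH]; first by rewrite /height !big_nil invg1.
rewrite rev_cons -cats1 height_cat IH big_cons invMg; congr (_ * _).
by rewrite /height big_seq1; case: b; rewrite /= ?invgK.
Qed.

Lemma flow_local_tension_dual (gT : finGroupType) (psi : E -> gT) :
  flow H psi <-> local_tension (dual H) psi.
Proof.
split=> [fl W|loc v s cyc _]; last first.
  apply: invg_inj; rewrite invg1 -height_rev_flow; apply: loc.
  by rewrite ucycle_dual_rev revK.
rewrite ucycle_dual_rev => cyc; rewrite -[W]revK height_rev_flow.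
(* A nonempty facial walk of the dual runs around the vertex [org H d] of its first dart. *)
case: W cyc => [|d W] cyc; first by rewrite big_nil invg1.
rewrite (fl (org H d) _ cyc) ?invg1 // => c; apply: ucycle_next_end cyc _ _.
by rewrite mem_rev mem_head.
Qed.

(** * Connectedness of the dual *)

Lemma right_face_step d : right_face H (face_step H d) = right_face H d.
Proof.
congr inl; apply: val_inj; apply/setP=> c; rewrite !inE /=.
apply: (same_connect (fconnect_sym (@face_step_inj _ _ H))).
by rewrite fconnect_sym ?fconnect1 //; apply: face_step_inj.
Qed.

Lemma org_dual d : org (dual H) d = right_face H (opp d).
Proof. by case: d => e []. Qed.

Lemma dual_walk_opp d :
  is_walk (dual H) (right_face H d) [:: opp d] (right_face H (opp d)).
Proof. by rewrite /= !org_dual !oppK. Qed.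

Lemma dual_walk_org c d : org H c = org H d ->
  exists W, is_walk (dual H) (right_face H c) W (right_face H d).
Proof.
move/(next_endP H) => [n <-]; elim: n => [|n [W wW]]; first by exists [::].
set b := iter n _ _ in wW.
(* [next_end H b] is the face step after [opp b], so passing to the next end around a vertex means
   crossing the edge of [b]. *)
have nb : right_face H (next_end H b) = right_face H (opp b).
  by rewrite -[RHS]right_face_step /face_step oppK.
exists (W ++ [:: opp b]); rewrite /= -/b nb.
exact: is_walk_cat wW (dual_walk_opp b).
Qed.

(** Follow a walk of [H] from [org H c] to [org H d]: turn around each vertex to the next dart of
    the walk, then cross that dart's edge. *)
Lemma dual_walk_right_face c d : connected H ->
  exists W, is_walk (dual H) (right_face H c) W (right_face H d).
Proof.
case=> _ /(_ (org H c) (org H d)) [W]; elim: W c => [c|b W IH c [ob w]].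
  exact: dual_walk_org.
have [W1 w1] := dual_walk_org (esym ob); have [W2 w2] := IH _ w.
exists (W1 ++ [:: opp b] ++ W2).
exact: is_walk_cat w1 (is_walk_cat (dual_walk_opp b) w2).
Qed.

Lemma isolated_walk v a W : isolated H v -> is_walk H v W a -> W = [::] /\ a = v.
Proof.
move=> /forallP iso; case: W => [-> //|[e b] W [ov _]].
by have := iso e; rewrite -ov /org; case: b {ov}; rewrite eqxx ?andbF.
Qed.

Lemma connected_isolated v (a : V) : connected H -> isolated H v -> a = v.
Proof.
by case=> _ /(_ v a) [W wW] iso; case: (isolated_walk iso wW).
Qed.

Lemma connected_isolated_edgeless v (e : E) :
  connected H -> isolated H v -> False.
Proof.
move=> conn iso; have := forallP iso e.
by rewrite (connected_isolated (src H e) conn iso) eqxx.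
Qed.

Lemma dual_connected : connected H -> connected (dual H).
Proof.
move=> conn; have [[v] _] := conn; split.
  have [iso|] := boolP (isolated H v).
    exact: (inhabits (inr (exist _ v iso))).
  by case/forallPn => e _; exact: (inhabits (right_face H (e, false))).
have rightE F : F \in codom (face_of H) -> exists d, F = face_of H d.
  by case/codomP=> d ->; exists d.
(* Faces of the two kinds cannot coexist: an isolated vertex of a connected graph is its only vertex
   and excludes edges. *)
case=> [[F Fc]|[u ui]] [[F' Fc']|[u' ui']].
- have [d dE] := rightE _ Fc; have [d' dE'] := rightE _ Fc'; subst F F'.
  have [W wW] := dual_walk_right_face d d' conn; exists W.
  congr (is_walk _ _ _ _): wW; congr inl; exact: val_inj.
- by have [d _] := rightE _ Fc; case: (connected_isolated_edgeless d.1 conn ui').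
- by have [d _] := rightE _ Fc'; case: (connected_isolated_edgeless d.1 conn ui).
- exists [::] => /=; congr inr; apply: val_inj => /=.
  exact: connected_isolated ui'.
Qed.

End Dual.

Theorem theorem4p8 (gT : finGroupType) (V E : finType) (H : rotgraph V E)
    (Hconn : connected H) :
  (forall (psi : E -> gT) (x : face H), flow H psi ->
     minimal_global_covering_tension (dual H)
       (derived (dual H) x psi) (derived_proj (dual H) x psi)
       (psi \o on_e (derived_proj (dual H) x psi))) /\
  (forall (VK EK : Type) (K : rotgraph VK EK) (s : gmap VK EK (face H) E)
     (phi : EK -> gT),
     minimal_global_covering_tension (dual H) K s phi ->
     flow H (descend s phi)).
Proof.
split=> [psi x /flow_local_tension_dual loc|VK EK K s phi [[_ _ _ loc] _]].
  exact: derived_minimal_global_covering_tension (dual_connected Hconn) loc.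
exact/flow_local_tension_dual.
Qed.
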